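(* Let $M$ be an oriented surface in Euclidean 3-space $E^3$ with unit normal field, let $\alpha=\alpha(s)$ be a curve on $M$ parametrized by arc length $s$, and let $\{T,g,n\}$ be its Darboux frame, with geodesic curvature $\kappa_g$, normal curvature $\kappa_n$ and geodesic torsion $\tau_g$. Let $\phi=\phi(s)$ be a differentiable two-component spinor field along $\alpha$ (a $\mathbb{C}^2$-valued function of $s$) that represents the triad $\{g,n,T\}$, i.e. for all $s$ $$g+in=\phi^t\sigma\phi,\qquad T=-\hat{\phi}^t\sigma\phi,\qquad \bar{\phi}^t\phi=1 .$$ Then the Darboux equations $$\frac{dT}{ds}=\kappa_g\, g+\kappa_n\, n,\qquad \frac{dg}{ds}=-\kappa_g\, T+\tau_g\, n,\qquad \frac{dn}{ds}=-\kappa_n\, T-\tau_g\, g$$ are equivalent to the single spinor equation $$\frac{d\phi}{ds}=\left(-i\frac{\tau_g}{2}\right)\phi+\left(\frac{i\kappa_n+\kappa_g}{2}\right)\hat{\phi}.$$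
   Context: Spinors: a spinor is a column vector $\psi=\begin{pmatrix}\psi_1\\ \psi_2\end{pmatrix}\in\mathbb{C}^2$; $t$ denotes transposition, a bar denotes complex conjugation, and the mate of $\psi$ is $\hat{\psi}=\begin{pmatrix}-\bar{\psi}_2\\ \bar{\psi}_1\end{pmatrix}$. The symbol $\sigma=(\sigma_1,\sigma_2,\sigma_3)$ is the vector of complex symmetric matrices $$\sigma_1=\begin{pmatrix}1&0\\0&-1\end{pmatrix},\quad \sigma_2=\begin{pmatrix}i&0\\0&i\end{pmatrix},\quad \sigma_3=\begin{pmatrix}0&-1\\-1&0\end{pmatrix},$$ and for spinors $\phi,\psi$ the expression $\phi^t\sigma\psi\in\mathbb{C}^3$ is the vector with components $\phi^t\sigma_k\psi$, $k=1,2,3$. Explicitly, $\psi^t\sigma\psi=(\psi_1^2-\psi_2^2,\ i(\psi_1^2+\psi_2^2),\ -2\psi_1\psi_2)$ and $-\hat{\psi}^t\sigma\psi=(\psi_1\bar{\psi}_2+\bar{\psi}_1\psi_2,\ i(\psi_1\bar{\psi}_2-\bar{\psi}_1\psi_2),\ |\psi_1|^2-|\psi_2|^2)$. A spinor representing a given positively oriented orthonormal triad exists and is unique up to sign. Darboux frame: for a unit speed curve $\alpha$ on the oriented surface $M$, $T=\alpha'$ is the unit tangent of the curve, $n$ is the unit normal of $M$ along $\alpha$, and $g=n\wedge T$ (cross product). The geodesic curvature, normal curvature and geodesic torsion of $\alpha$ are the real functions $\kappa_g=\langle T',g\rangle$, $\kappa_n=\langle T',n\rangle$, $\tau_g=\langle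 g',n\rangle$, where $'=d/ds$. All data are assumed differentiable as needed. *)

(* Defs.v *)
From HB Require Import structures.
From mathcomp Require Import all_boot all_order all_algebra.
From mathcomp Require Import all_classical all_reals all_analysis.
From mathcomp Require Import complex.
Set Implicit Arguments.
Unset Strict Implicit.
Unset Printing Implicit Defensive.
Import Order.TTheory GRing.Theory Num.Theory.
Import numFieldNormedType.Exports.
Local Open Scope classical_set_scope.
Local Open Scope ring_scope.
Local Open Scope complex_scope.

Definition dot (R : realType) (u v : 'rV[R]_3) : R := \sum_(k < 3) u 0 k * v 0 k.

Definition cross (R : realType) (u v : 'rV[R]_3) : 'rV[R]_3 :=
  \row_k nth 0 [:: u 0 1 * v 0 2 - u 0 2 * v 0 1;
                   u 0 2 * v 0 0 - u 0 0 * v 0 2;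
                   u 0 0 * v 0 1 - u 0 1 * v 0 0] k.

(* [x] is a local parametrization, defined on the open set [U], of the piece
   [M `&` V] of [M]: of class C^1, regular, and a homeomorphism onto its image
   (with inverse [y]). *)
Definition local_parametrization (R : realType) (M : set 'rV[R]_3)
    (U : set 'rV[R]_2) (V : set 'rV[R]_3) (x : 'rV[R]_2 -> 'rV[R]_3) : Prop :=
  [/\ x @` U = M `&` V,
      forall q, U q -> differentiable x q,
      forall v q, U q -> {for q, continuous (fun z => 'D_v x z)},
      forall q, U q -> injective ('d x q) &
      exists2 y : 'rV[R]_3 -> 'rV[R]_2,
        {within M `&` V, continuous y} & forall q, U q -> y (x q) = q].

Definition regular_surface (R : realType) (M : set 'rV[R]_3) : Prop :=
  forall p, M p ->
    exists (U : set 'rV[R]_2) (V : set 'rV[R]_3) (x : 'rV[R]_2 -> 'rV[R]_3),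
      [/\ open U, open V, V p & local_parametrization M U V x].

Definition tangent_vector (R : realType) (M : set 'rV[R]_3)
    (p v : 'rV[R]_3) : Prop :=
  exists (c : R -> 'rV[R]_3) (e : R),
    [/\ 0 < e,
        forall t, `|t| < e -> M (c t) /\ derivable c t 1,
        c 0 = p & derive1 c 0 = v].

Definition unit_normal_field (R : realType) (M : set 'rV[R]_3)
    (N : 'rV[R]_3 -> 'rV[R]_3) : Prop :=
  [/\ {within M, continuous N},
      forall p, M p -> dot (N p) (N p) = 1 &
      forall p v, M p -> tangent_vector M p v -> dot (N p) v = 0].

Definition unit_speed_curve_on (R : realType) (M : set 'rV[R]_3) (I : set R)
    (alpha : R -> 'rV[R]_3) : Prop :=
  forall s, I s ->
    [/\ M (alpha s), derivable alpha s 1 & dot (derive1 alpha s) (derive1 alpha s) = 1].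

Section DarbouxFrame.
Variables (R : realType) (N : 'rV[R]_3 -> 'rV[R]_3) (alpha : R -> 'rV[R]_3).

Definition frameT : R -> 'rV[R]_3 := derive1 alpha.
Definition framen : R -> 'rV[R]_3 := fun s => N (alpha s).
Definition frameg : R -> 'rV[R]_3 := fun s => cross (framen s) (frameT s).

Definition kappag (s : R) : R := dot (derive1 frameT s) (frameg s).
Definition kappan (s : R) : R := dot (derive1 frameT s) (framen s).
Definition taug (s : R) : R := dot (derive1 frameg s) (framen s).

Definition darboux_equations (s : R) : Prop :=
  [/\ derive1 frameT s = kappag s *: frameg s + kappan s *: framen s,
      derive1 frameg s = - kappag s *: frameT s + taug s *: framen s &
      derive1 framen s = - kappan s *: frameT s - taug s *: frameg s].

End DarbouxFrame.

Definition mx22 (K : nzRingType) (a b c d : K) : 'M[K]_2 :=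
  \matrix_(i, j) nth 0 (nth [::] [:: [:: a; b]; [:: c; d]] i) j.

(* The three matrices are indexed from 0. *)
Definition sigma (R : realType) (k : 'I_3) : 'M[R[i]]_2 :=
  nth 0 [:: mx22 1 0 0 (-1); mx22 'i 0 0 'i; mx22 0 (-1) (-1) 0] k.

Definition sigma_prod (R : realType) (phi psi : 'cV[R[i]]_2) : 'rV[R[i]]_3 :=
  \row_k (phi^T *m sigma R k *m psi) 0 0.

Definition mate (R : realType) (psi : 'cV[R[i]]_2) : 'cV[R[i]]_2 :=
  \col_j nth 0 [:: - (psi 1 0)^*; (psi 0 0)^*] j.

Definition complexify (R : realType) (u : 'rV[R]_3) : 'rV[R[i]]_3 :=
  map_mx (real_complex R) u.

Definition represents_triad (R : realType) (psi : 'cV[R[i]]_2)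
    (a b c : 'rV[R]_3) : Prop :=
  [/\ complexify a + 'i *: complexify b = sigma_prod psi psi,
      complexify c = - sigma_prod (mate psi) psi &
      (map_mx conjc psi)^T *m psi = 1%:M].

(* The library has no topology making [R[i]] a normed space over [R]:
   derivatives of C^2-valued functions of a real variable are taken on the real
   and imaginary parts of the components. *)
Definition spinor_derivable (R : realType) (phi : R -> 'cV[R[i]]_2) (s : R) : Prop :=
  forall j, derivable (fun t => complex.Re (phi t j 0)) s 1 /\
            derivable (fun t => complex.Im (phi t j 0)) s 1.

Definition spinor_derive (R : realType) (phi : R -> 'cV[R[i]]_2) (s : R) :
    'cV[R[i]]_2 :=
  \col_j (derive1 (fun t => complex.Re (phi t j 0)) s +i*
          derive1 (fun t => complex.Im (phi t j 0)) s).

Definition spinor_equation (R : realType) (N : 'rV[R]_3 -> 'rV[R]_3)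
    (alpha : R -> 'rV[R]_3) (phi : R -> 'cV[R[i]]_2) (s : R) : Prop :=
  spinor_derive phi s =
    - 'i * ((taug N alpha s)%:C / 2) *: phi s
    + (('i * (kappan N alpha s)%:C + (kappag N alpha s)%:C) / 2) *: mate (phi s).

(* Main.v *)
(** Differentiating [g + i n = phi^t sigma phi] and [T = - mate(phi)^t sigma phi]
    gives [g' + i n' = 2 phi^t sigma phi'] and a similar formula for [T'].  Let
    [chi] be the right-hand side of the spinor equation.  Since
    [phi^t sigma mate(phi) = - T], the number [2 phi^t sigma chi] is exactly the
    value of [g' + i n'] prescribed by the last two Darboux equations, so
    [phi' = chi] gives these two; the first one follows in the same way from
    [mate(phi)^t sigma mate(phi) = - (g - i n)].  Conversely the Darboux equations
    give [phi^t sigma (phi' - chi) = 0], and [psi |-> phi^t sigma psi] is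
    injective because [phi] does not vanish. *)
Require Import Defs.
From mathcomp Require Import all_boot all_order all_algebra.
From mathcomp Require Import all_classical all_reals all_analysis.
From mathcomp Require Import complex ring.
Set Implicit Arguments.
Unset Strict Implicit.
Unset Printing Implicit Defensive.
Import GRing.Theory Num.Theory.
Import numFieldNormedType.Exports.
Local Open Scope classical_set_scope.
Local Open Scope ring_scope.
Local Open Scope complex_scope.

(** * Calculus of complex-valued and matrix-valued functions of a real variable *)

Definition has_cderive (R : realType) (f : R -> R[i]) (s : R) (df : R[i]) : Prop :=
  is_derive s 1 (fun t => complex.Re (f t)) (complex.Re df) /\
  is_derive s 1 (fun t => complex.Im (f t)) (complex.Im df).

(** Like [is_derive], these relations carry existence and value of the derivative together, so the
    product rules compose without side conditions. *)
Definition has_mxcderive (R : realType) (m n : nat) (F : R -> 'M[R[i]]_(m, n))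
    (s : R) (dF : 'M[R[i]]_(m, n)) : Prop :=
  forall i j, has_cderive (fun t => F t i j) s (dF i j).

Section ComplexDerivative.
Variables (R : realType) (s : R).
Implicit Types (f g : R -> R[i]) (df dg c : R[i]).

Lemma ReD (x y : R[i]) : complex.Re (x + y) = complex.Re x + complex.Re y.
Proof. by case: x => ? ?; case: y. Qed.

Lemma ImD (x y : R[i]) : complex.Im (x + y) = complex.Im x + complex.Im y.
Proof. by case: x => ? ?; case: y. Qed.

Lemma ReN (x : R[i]) : complex.Re (- x) = - complex.Re x.
Proof. by case: x. Qed.

Lemma ImN (x : R[i]) : complex.Im (- x) = - complex.Im x.
Proof. by case: x. Qed.

Lemma ReJ (x : R[i]) : complex.Re x^* = complex.Re x.
Proof. by case: x. Qed.

Lemma ImJ (x : R[i]) : complex.Im x^* = - complex.Im x.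
Proof. by case: x. Qed.

Lemma ReM (x y : R[i]) :
  complex.Re (x * y) = complex.Re x * complex.Re y - complex.Im x * complex.Im y.
Proof. by case: x => ? ?; case: y. Qed.

Lemma ImM (x y : R[i]) :
  complex.Im (x * y) = complex.Re x * complex.Im y + complex.Im x * complex.Re y.
Proof. by case: x => ? ?; case: y. Qed.

Lemma complex_ext (x y : R[i]) :
  complex.Re x = complex.Re y -> complex.Im x = complex.Im y -> x = y.
Proof. by case: x y => [a b] [c d] /= -> ->. Qed.

(** Turns the halves of the spinor equation into real scalars, on which [ReM] and [ImM] compute. *)
Lemma half_complex (x : R[i]) : x / 2 = x * (2^-1 : R)%:C.
Proof. by rewrite fmorphV rmorph_nat. Qed.

Lemma has_cderive_cst c : has_cderive (fun=> c) s 0.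
Proof. by split; exact: is_derive_cst. Qed.

Lemma has_cderiveD f g df dg :
  has_cderive f s df -> has_cderive g s dg ->
  has_cderive (fun t => f t + g t) s (df + dg).
Proof.
move=> [fr fi] [gr gi]; split.
- rewrite ReD (_ : (fun t => _) = (fun t => complex.Re (f t)) + fun t => complex.Re (g t)).
    exact: is_deriveD.
  by apply/funext => t; rewrite ReD.
- rewrite ImD (_ : (fun t => _) = (fun t => complex.Im (f t)) + fun t => complex.Im (g t)).
    exact: is_deriveD.
  by apply/funext => t; rewrite ImD.
Qed.

Lemma has_cderiveN f df : has_cderive f s df -> has_cderive (fun t => - f t) s (- df).
Proof.
move=> [fr fi]; split.
- rewrite ReN (_ : (fun t => _) = - fun t => complex.Re (f t)).
    exact: is_deriveN.
  by apply/funext => t; rewrite ReN.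
- rewrite ImN (_ : (fun t => _) = - fun t => complex.Im (f t)).
    exact: is_deriveN.
  by apply/funext => t; rewrite ImN.
Qed.

Lemma has_cderive_conj f df : has_cderive f s df -> has_cderive (fun t => (f t)^*) s df^*.
Proof.
move=> [fr fi]; split; rewrite /=.
- rewrite (_ : (fun t => _) = fun t => complex.Re (f t)); last first.
    by apply/funext => t; rewrite ReJ.
  by rewrite ReJ.
- rewrite (_ : (fun t => _) = - fun t => complex.Im (f t)); last first.
    by apply/funext => t; rewrite ImJ.
  by rewrite ImJ; exact: is_deriveN.
Qed.

Lemma has_cderiveM f g df dg :
  has_cderive f s df -> has_cderive g s dg ->
  has_cderive (fun t => f t * g t) s (df * g s + f s * dg).
Proof.
move=> [fr fi] [gr gi]; split.
- rewrite (_ : (fun t => _) =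
      (fun t => complex.Re (f t)) * (fun t => complex.Re (g t)) -
      (fun t => complex.Im (f t)) * (fun t => complex.Im (g t))).
    apply: (is_derive_eq (is_deriveB (is_deriveM fr gr) (is_deriveM fi gi))).
    by rewrite ReD !ReM /GRing.scale /=; ring.
  by apply/funext => t; rewrite ReM.
- rewrite (_ : (fun t => _) =
      (fun t => complex.Re (f t)) * (fun t => complex.Im (g t)) +
      (fun t => complex.Im (f t)) * (fun t => complex.Re (g t))).
    apply: (is_derive_eq (is_deriveD (is_deriveM fr gi) (is_deriveM fi gr))).
    by rewrite ImD !ImM /GRing.scale /=; ring.
  by apply/funext => t; rewrite ImM.
Qed.

Lemma has_cderive_sum (I : Type) (r : seq I) (F : I -> R -> R[i]) (dF : I -> R[i]) :
  (forall i, has_cderive (F i) s (dF i)) ->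
  has_cderive (fun t => \sum_(i <- r) F i t) s (\sum_(i <- r) dF i).
Proof.
move=> HF; elim: r => [|i r IH].
  rewrite big_nil (_ : (fun t => _) = fun=> 0); first exact: has_cderive_cst.
  by apply/funext => t; rewrite big_nil.
rewrite big_cons (_ : (fun t => _) = fun t => F i t + \sum_(j <- r) F j t).
  exact: has_cderiveD.
by apply/funext => t; rewrite big_cons.
Qed.

Lemma has_mxcderiveM m n p (F : R -> 'M[R[i]]_(m, n)) (G : R -> 'M[R[i]]_(n, p)) dF dG :
  has_mxcderive F s dF -> has_mxcderive G s dG ->
  has_mxcderive (fun t => F t *m G t) s (dF *m G s + F s *m dG).
Proof.
move=> HF HG i j; rewrite !mxE -big_split /=.
rewrite (_ : (fun t => _) = fun t => \sum_k F t i k * G t k j).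
  by apply: has_cderive_sum => k; exact: has_cderiveM.
by apply/funext => t; rewrite mxE.
Qed.

Lemma has_mxcderive_cst m n (A : 'M[R[i]]_(m, n)) : has_mxcderive (fun=> A) s 0.
Proof. by move=> i j; rewrite mxE; exact: has_cderive_cst. Qed.

Lemma has_mxcderiveN m n (F : R -> 'M[R[i]]_(m, n)) dF :
  has_mxcderive F s dF -> has_mxcderive (fun t => - F t) s (- dF).
Proof.
move=> HF i j; rewrite mxE (_ : (fun t => _) = fun t => - F t i j).
  exact: has_cderiveN.
by apply/funext => t; rewrite mxE.
Qed.

Lemma has_mxcderive_tr m n (F : R -> 'M[R[i]]_(m, n)) dF :
  has_mxcderive F s dF -> has_mxcderive (fun t => (F t)^T) s dF^T.
Proof.
move=> HF i j; rewrite mxE (_ : (fun t => _) = fun t => F t j i) //.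
by apply/funext => t; rewrite mxE.
Qed.

Lemma has_mxcderive_sigma_prod (phi psi : R -> 'cV[R[i]]_2) dphi dpsi :
  has_mxcderive phi s dphi -> has_mxcderive psi s dpsi ->
  has_mxcderive (fun t => sigma_prod (phi t) (psi t)) s
    (sigma_prod dphi (psi s) + sigma_prod (phi s) dpsi).
Proof.
move=> Hphi Hpsi i k.
have HS := has_mxcderiveM
  (has_mxcderive_tr Hphi) (has_mxcderive_cst (sigma R k)).
(* Component [k] is the only entry of a 1 x 1 product; the term coming from the constant matrix
   [sigma R k] vanishes. *)
have := has_mxcderiveM HS Hpsi 0 0.
rewrite mulmx0 addr0 [X in has_cderive _ _ X -> _]mxE.
rewrite [X in _ -> has_cderive _ _ X]mxE [X in _ -> has_cderive _ _ (X + _)]mxE.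
rewrite [X in _ -> has_cderive _ _ (_ + X)]mxE.
by congr (has_cderive _ s _); apply/funext => t; rewrite [RHS]mxE.
Qed.

(** Although antilinear over [R[i]], [mate] is linear over the reals, so it commutes with
    differentiation in a real variable. *)
Lemma has_mxcderive_mate (phi : R -> 'cV[R[i]]_2) dphi :
  has_mxcderive phi s dphi -> has_mxcderive (fun t => mate (phi t)) s (mate dphi).
Proof.
move=> Hphi j k; rewrite mxE.
case: j => [[|[|//]] /= ltj].
- rewrite (_ : (fun t => _) = fun t => - (phi t 1 0)^*).
    by apply: has_cderiveN; apply: has_cderive_conj.
  by apply/funext => t; rewrite mxE.
- rewrite (_ : (fun t => _) = fun t => (phi t 0 0)^*).
    by apply: has_cderive_conj.
  by apply/funext => t; rewrite mxE.
Qed.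

Lemma has_mxcderive_spinor (phi : R -> 'cV[R[i]]_2) :
  spinor_derivable phi s -> has_mxcderive phi s (spinor_derive phi s).
Proof.
move=> dphi j k; rewrite (ord1 k) mxE; have [dr di] := dphi j.
by split; rewrite /= derive1E; apply/derivableP.
Qed.

(** Near [s], the entries of [u] and [v] are the real and imaginary parts of those of [F], so their
    derivability is deduced rather than assumed. This is how the frame inherits differentiability
    from the spinor, while [N] is only assumed continuous. *)
Lemma derive1_complexify m n (u v : R -> 'M[R]_(m, n)) (F : R -> 'M[R[i]]_(m, n)) dF :
  has_mxcderive F s dF ->
  (\forall t \near s, map_mx (real_complex R) (u t) + 'i *: map_mx (real_complex R) (v t) = F t) ->
  map_mx (real_complex R) (derive1 u s) + 'i *: map_mx (real_complex R) (derive1 v s) = dF.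
Proof.
move=> HF uvF.
have du i j : is_derive s 1 (fun t => u t i j) (complex.Re (dF i j)).
  apply: near_eq_is_derive (HF i j).1; apply: filterS uvF => t <-.
  by rewrite !mxE ReD ReM /=; ring.
have dv i j : is_derive s 1 (fun t => v t i j) (complex.Im (dF i j)).
  apply: near_eq_is_derive (HF i j).2; apply: filterS uvF => t <-.
  by rewrite !mxE ImD ImM /=; ring.
have {}du : derive1 u s = \matrix_(i, j) complex.Re (dF i j).
  rewrite derive1E derive_mx; last by apply/derivable_mxP => i j.
  by apply/matrixP => i j; rewrite !mxE derive_val.
have {}dv : derive1 v s = \matrix_(i, j) complex.Im (dF i j).
  rewrite derive1E derive_mx; last by apply/derivable_mxP => i j.
  by apply/matrixP => i j; rewrite !mxE derive_val.
apply/matrixP => i j; rewrite du dv !mxE.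
by case: (dF i j) => a b; apply: complex_ext; rewrite /=; ring.
Qed.

End ComplexDerivative.

(** * Algebra of [sigma_prod] and [mate] *)

Section SpinorAlgebra.
Variable R : realType.
Implicit Types (phi psi chi : 'cV[R[i]]_2) (c : R[i]).

Lemma sigma_prodE phi psi : sigma_prod phi psi =
  \row_k nth 0 [:: phi 0 0 * psi 0 0 - phi 1 0 * psi 1 0;
                   'i * (phi 0 0 * psi 0 0 + phi 1 0 * psi 1 0);
                   - (phi 0 0 * psi 1 0 + phi 1 0 * psi 0 0)] k.
Proof.
apply/rowP => k; rewrite !mxE !big_ord_recl big_ord0 !mxE.
rewrite !big_ord_recl !big_ord0 !mxE /=.
rewrite (_ : lift ord0 ord0 = 1); last exact/val_inj.
by case: k => [[|[|[|//]]] /= ltk]; rewrite /sigma /mx22 /= !mxE /=; ring.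
Qed.

Lemma sigma_prodC phi psi : sigma_prod phi psi = sigma_prod psi phi.
Proof.
rewrite !sigma_prodE; apply/rowP => k; rewrite !mxE.
by case: k => [[|[|[|//]]] /= ltk]; ring.
Qed.

Lemma sigma_prodDr phi psi chi :
  sigma_prod phi (psi + chi) = sigma_prod phi psi + sigma_prod phi chi.
Proof.
apply/rowP => k; rewrite [RHS]mxE [X in _ = X + _]mxE [X in _ = _ + X]mxE [LHS]mxE.
by rewrite mulmxDr [LHS]mxE.
Qed.

Lemma sigma_prodZr c phi psi : sigma_prod phi (c *: psi) = c *: sigma_prod phi psi.
Proof.
by apply/rowP => k; rewrite [RHS]mxE [X in _ = _ * X]mxE [LHS]mxE -scalemxAr [LHS]mxE.
Qed.

Lemma sigma_prodNr phi psi : sigma_prod phi (- psi) = - sigma_prod phi psi.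
Proof. by rewrite -scaleN1r sigma_prodZr scaleN1r. Qed.

(** For [phi] = (a, b) and [psi] = (x, y), the first two components give ax = by and ax = -by, hence
    ax = by = 0; the third gives ay + bx = 0. A nonzero a or b then forces x = y = 0. *)
Lemma sigma_prod_eq0 phi psi : phi != 0 -> sigma_prod phi psi = 0 -> psi = 0.
Proof.
move=> phi0; rewrite sigma_prodE => /rowP H.
have /eqP h0 := H 0; have /eqP h1 := H 1; have /eqP h2 := H 2%:R.
move: h0 h1 h2; rewrite !mxE /= subr_eq0 mulf_eq0 oppr_eq0.
have i0 : 'i != 0 :> R[i] by rewrite eq_complex /= oner_eq0 andbF.
rewrite (negPf i0) /= => /eqP e0; rewrite -e0 -mulr2n mulrn_eq0 /= => /eqP z0.
rewrite z0 in e0; move/esym/eqP: e0; move/eqP: z0; rewrite !mulf_eq0.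
have ext (u : 'cV[R[i]]_2) : u 0 0 = 0 -> u 1 0 = 0 -> u = 0.
  move=> u0 u1; apply/colP => -[[|[|//]] ltj]; rewrite mxE.
  - by rewrite -[RHS]u0; congr (u _ _); exact/val_inj.
  - by rewrite -[RHS]u1; congr (u _ _); exact/val_inj.
have [a0|a0] /= := eqVneq (phi 0 0) 0; have [b0|b0] /= := eqVneq (phi 1 0) 0.
- by rewrite (ext phi a0 b0) eqxx in phi0.
- move=> _ /eqP y0; rewrite a0 mul0r add0r mulf_eq0 (negPf b0) /= => /eqP x0.
  exact: ext.
- move=> /eqP x0 _; rewrite b0 mul0r addr0 mulf_eq0 (negPf a0) /= => /eqP y0.
  exact: ext.
- by move=> /eqP x0 /eqP y0 _; exact: ext.
Qed.

Lemma mateD phi psi : mate (phi + psi) = mate phi + mate psi.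
Proof.
apply/colP => j; rewrite !mxE.
by case: j => [[|[|//]] /= _]; rewrite rmorphD //= opprD.
Qed.

Lemma mateZ c phi : mate (c *: phi) = c^* *: mate phi.
Proof.
apply/colP => j; rewrite !mxE.
by case: j => [[|[|//]] /= _]; rewrite rmorphM //= mulrN.
Qed.

(** With [mateZ], this makes [mate] a quaternionic structure on the space of spinors. *)
Lemma mateK phi : mate (mate phi) = - phi.
Proof.
apply/colP => j; rewrite !mxE.
case: j => [[|[|//]] /= lej].
- rewrite (_ : Ordinal lej = 0); last exact/val_inj.
  by apply: complex_ext; rewrite !(ReN, ImN, ReJ, ImJ) ?opprK.
- rewrite (_ : Ordinal lej = 1); last exact/val_inj.
  by apply: complex_ext; rewrite !(ReN, ImN, ReJ, ImJ) ?opprK.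
Qed.

(** The mate is the conjugate spinor rotated by the real matrix J = ((0, -1), (1, 0)), and J^t
    sigma_k J is minus the conjugate of sigma_k. *)
Lemma sigma_prod_mate phi psi :
  sigma_prod (mate phi) (mate psi) = - map_mx conjc (sigma_prod phi psi).
Proof.
rewrite !sigma_prodE; apply/rowP => k; rewrite !mxE.
by case: k => [[|[|[|//]]] /= ltk]; apply: complex_ext;
  rewrite !(ReN, ImN, ReJ, ImJ, ReD, ImD, ReM, ImM) /=; ring.
Qed.

End SpinorAlgebra.

(** * Equivalence of the two systems, point by point *)

Lemma complexify_inj (R : realType) (u v u' v' : 'rV[R]_3) :
  complexify u + 'i *: complexify v = complexify u' + 'i *: complexify v' ->
  u = u' /\ v = v'.
Proof.
move=> /rowP H; split; apply/rowP => k; have := H k; rewrite !mxE.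
- by move=> /(congr1 (@complex.Re R)); rewrite /= !mul0r !mul1r !subr0 !addr0.
- by move=> /(congr1 (@complex.Im R)); rewrite /= !mul0r !mul1r !add0r.
Qed.

Theorem theorem3p1 (R : realType) (M : set 'rV[R]_3) (N : 'rV[R]_3 -> 'rV[R]_3)
    (I : set R) (alpha : R -> 'rV[R]_3) (phi : R -> 'cV[R[i]]_2)
    (hM : regular_surface M) (hN : unit_normal_field M N)
    (openI : open I) (intervalI : is_interval I)
    (halpha : unit_speed_curve_on M I alpha)
    (dphi : forall s, I s -> spinor_derivable phi s)
    (hphi : forall s, I s ->
       represents_triad (phi s) (frameg N alpha s) (framen N alpha s) (frameT alpha s)) :
  (forall s, I s -> darboux_equations N alpha s) <->
  (forall s, I s -> spinor_equation N alpha phi s).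
Proof.
suff H s : I s -> darboux_equations N alpha s <-> spinor_equation N alpha phi s.
  by split=> h s Is; apply/H => //; exact: h.
(* As [I] is open, the relations between spinor and triad hold near [s] and can be differentiated
   there. *)
move=> Is; have nearI : \forall t \near s, I t by exact: open_nbhs_nbhs.
rewrite /spinor_equation /darboux_equations.
have Hphi := has_mxcderive_spinor (dphi s Is).
set D := spinor_derive phi s in Hphi *.
have [gn TE nrm] := hphi s Is.
have dgn : complexify (derive1 (frameg N alpha) s) +
    'i *: complexify (derive1 (framen N alpha) s) = 2 *: sigma_prod (phi s) D.
  rewrite scaler_nat mulr2n {1}sigma_prodC.
  apply: derive1_complexify (has_mxcderive_sigma_prod Hphi Hphi) _.
  by apply: filterS nearI => t /hphi[].
have dT : complexify (derive1 (frameT alpha) s) =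
    - (sigma_prod (mate D) (phi s) + sigma_prod (mate (phi s)) D).
  have Hm := has_mxcderive_mate Hphi.
  (* [T] is real: it enters with imaginary part 0. *)
  have := derive1_complexify (u := frameT alpha) (v := fun=> 0)
    (has_mxcderiveN (has_mxcderive_sigma_prod Hm Hphi)).
  rewrite derive1_cst map_mx0 scaler0 addr0; apply.
  by apply: filterS nearI => t /hphi[_ <- _]; rewrite addr0.
(* From here on the three coefficients are arbitrary reals shared by both systems. *)
move: (kappag N alpha s) (kappan N alpha s) (taug N alpha s) => kg kn tau.
set chi := _ *: phi s + _.
have phi0 : phi s != 0.
  (* A zero spinor would turn the normalization into 0 = 1. *)
  apply/eqP => p0; move: nrm; rewrite p0 mulmx0 => /matrixP /(_ 0 0).
  by rewrite !mxE /= => /eqP; rewrite eq_sym oner_eq0.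
have gnchi : complexify (- kg *: frameT alpha s + tau *: framen N alpha s) +
    'i *: complexify (- kn *: frameT alpha s - tau *: frameg N alpha s) =
    2 *: sigma_prod (phi s) chi.
  (* The right-hand side becomes -i tau (g + i n) - (kg + i kn) T, whose real and imaginary parts
     are the two combinations on the left. *)
  rewrite sigma_prodDr !sigma_prodZr (sigma_prodC (phi s) (mate _)) -gn.
  rewrite -[sigma_prod (mate _) _]opprK -TE.
  move: (frameg N alpha s) (framen N alpha s) (frameT alpha s) => g n T.
  by apply/rowP => k; rewrite !mxE !half_complex; apply: complex_ext;
    rewrite !(ReN, ImN, ReJ, ImJ, ReD, ImD, ReM, ImM) /=; field.
have Tchi : D = chi -> derive1 (frameT alpha) s = kg *: frameg N alpha s + kn *: framen N alpha s.
  move=> Dchi; apply: (@complexify_inj _ _ 0 _ 0 _).1; rewrite dT Dchi.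
  (* Here [mate chi] is (i tau / 2) [mate phi] - ((kg - i kn) / 2) [phi]. The tau terms cancel, and
     what remains is the sum of (kg - i kn)(g + i n) / 2 and its conjugate, that is kg g + kn n. *)
  rewrite mateD !mateZ mateK sigma_prodC !sigma_prodDr !sigma_prodZr sigma_prodNr.
  rewrite (sigma_prodC (phi s) (mate _)) sigma_prod_mate -gn.
  rewrite -[sigma_prod (mate _) _]opprK -TE.
  move: (frameg N alpha s) (framen N alpha s) (frameT alpha s) => g n T.
  by apply/rowP => k; rewrite !mxE !half_complex; apply: complex_ext;
    rewrite !(ReN, ImN, ReJ, ImJ, ReD, ImD, ReM, ImM) /=; field.
split=> [[_ dg dn]|Dchi].
- apply/eqP; rewrite -subr_eq0; apply/eqP/(sigma_prod_eq0 phi0).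
  rewrite sigma_prodDr sigma_prodNr; apply/eqP; rewrite subr_eq0.
  have two0 : (2 : R[i]) != 0 by rewrite pnatr_eq0.
  by move: dgn; rewrite dg dn gnchi => /(scalerI two0) ->.
- have [dg dn] := complexify_inj (etrans dgn (etrans (congr1 _ (congr1 _ Dchi)) (esym gnchi))).
  by split=> //; exact: Tchi.
Qed.
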